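(* Let $A$ be a real symmetric positive definite $n\times n$ matrix, let $U=\{u_1,\dots,u_n\}$ be a presentation of $A$ (regarded also as the matrix with columns $u_i$), and let $u_0$ be the orthogonal projection of the origin onto the affine span $\mathrm{aff}\,U$. Then $u_0=\frac{1}{\mathbf 1^tA^{-1}\mathbf 1}UA^{-1}\mathbf 1$, and the following are equivalent: (1) $A-\|u_0\|^2J$ has a presentation in good position; (2) $u_0$ lies in the interior (relative to $\mathrm{aff}\,U$) of the convex hull of $U$; (3) every coordinate of $A^{-1}\mathbf 1$ is strictly positive.
   Context: A presentation of a real symmetric positive semidefinite $n\times n$ matrix $A=(a_{ij})$ is an ordered set $U=\{u_1,\dots,u_n\}\subset\mathbb R^n$ with $(u_i,u_j)=a_{ij}$. $\mathrm{aff}\,U=\{\sum_i\alpha_iu_i:\sum_i\alpha_i=1\}$. A set of $n$ vectors in $\mathbb R^n$ is in good position if its convex hull has dimension $n-1$ and contains the origin in its interior (relative to its affine hull). $\mathbf 1$ is the all-ones column vector and $J=\mathbf 1\mathbf 1^t$. *)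

(* Defs.v *)
From mathcomp Require Import all_boot all_order all_algebra.
From mathcomp Require Import boolp classical_sets reals topology.

Set Implicit Arguments.
Unset Strict Implicit.
Unset Printing Implicit Defensive.

Import Order.TTheory GRing.Theory Num.Theory.
Import numFieldTopology.Exports.

Local Open Scope classical_set_scope.
Local Open Scope ring_scope.

Definition dotv (R : realType) (n : nat) (u v : 'cV[R]_n) : R :=
  \sum_(i < n) u i 0 * v i 0.

(* The Euclidean norm; the norm that the library puts on matrices is the
   sup norm. *)
Definition enorm (R : realType) (n : nat) (u : 'cV[R]_n) : R :=
  Num.sqrt (dotv u u).

Definition ones (R : realType) (n : nat) : 'cV[R]_n := const_mx 1.
Arguments ones {R n}.

Definition symmetric_mx (R : realType) (n : nat) (A : 'M[R]_n) : Prop :=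
  A^T = A.

Definition positive_definite (R : realType) (n : nat) (A : 'M[R]_n) : Prop :=
  forall x : 'cV[R]_n, x != 0 -> 0 < (x^T *m A *m x) 0 0.

(* A family u_1, ..., u_n of vectors of R^n is the n x n matrix whose columns
   are the u_i. *)
Definition presentation (R : realType) (n : nat) (A U : 'M[R]_n) : Prop :=
  forall i j : 'I_n, dotv (col i U) (col j U) = A i j.

Definition aff (R : realType) (n : nat) (U : 'M[R]_n) : set 'cV[R]_n :=
  [set x | exists a : 'I_n -> R,
     \sum_(i < n) a i = 1 /\ x = \sum_(i < n) a i *: col i U].

Definition conv_hull (R : realType) (n : nat) (U : 'M[R]_n) : set 'cV[R]_n :=
  [set x | exists a : 'I_n -> R,
     [/\ forall i, 0 <= a i, \sum_(i < n) a i = 1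
       & x = \sum_(i < n) a i *: col i U]].

(* The affine hull of an arbitrary, possibly infinite, set of vectors. *)
Definition affine_hull (R : realType) (n : nat) (C : set 'cV[R]_n) :
    set 'cV[R]_n :=
  [set x | exists (m : nat) (a : 'I_m -> R) (p : 'I_m -> 'cV[R]_n),
     [/\ forall i, C (p i), \sum_(i < m) a i = 1
       & x = \sum_(i < m) a i *: p i]].

(* C has dimension d: its affine hull is a translate of a linear subspace of
   dimension d. *)
Definition has_dim (R : realType) (n : nat) (C : set 'cV[R]_n) (d : nat) :
    Prop :=
  exists (p : 'cV[R]_n) (L : {vspace 'cV[R]_n}),
    affine_hull C = [set x | x - p \in L] /\ \dim L = d.

Definition rel_interior (R : realType) (n : nat) (E C : set 'cV[R]_n) :
    set 'cV[R]_n :=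
  [set x | E x /\ within E (nbhs x) C].

(* n.-1 is only truncated for n = 0, where the convex hull is empty and hence
   the second condition fails. *)
Definition good_position (R : realType) (n : nat) (U : 'M[R]_n) : Prop :=
  has_dim (conv_hull U) n.-1 /\
  rel_interior (affine_hull (conv_hull U)) (conv_hull U) 0.

(* q is the orthogonal projection of p onto the affine subspace E. *)
Definition is_orth_proj (R : realType) (n : nat) (E : set 'cV[R]_n)
    (p q : 'cV[R]_n) : Prop :=
  E q /\ forall x, E x -> dotv (p - q) (x - q) = 0.

(* Main.v *)
Require Import Defs.
From mathcomp Require Import all_boot all_order all_algebra.
From mathcomp Require Import boolp classical_sets reals topology.

(** Writing points of [aff U] in barycentric coordinates, [u0 = U a] with
    [1^t a = 1]; orthogonality of [u0] to the differences [u_i - u0] reads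
    [A a = |u0|^2 1], so [a] is [A^-1 1] up to the positive scalar [|u0|^2].
    For an affinely independent family the relative interior of the simplex
    consists of the points all of whose barycentric coordinates are positive,
    which gives (2) <-> (3). Any presentation [V] of [A - |u0|^2 J] satisfies
    [ker V = ker (A - |u0|^2 J)], which is the line spanned by [a]; hence [V]
    is affinely independent of rank [n - 1], and the origin has barycentric
    coordinates [a] in it, which gives (1) <-> (3). The translates [u_i - u0]
    provide such a presentation. *)

Set Implicit Arguments.
Unset Strict Implicit.
Unset Printing Implicit Defensive.

Import Order.TTheory GRing.Theory Num.Theory.
Import numFieldTopology.Exports.

Local Open Scope classical_set_scope.
Local Open Scope ring_scope.

Section Barycentric.
Variables (R : realType) (n : nat).
Implicit Types (V A : 'M[R]_n) (a b x y : 'cV[R]_n).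

(** * Scalar products and affine combinations as matrix products *)

Lemma dotvE x y : (dotv x y)%:M = x^T *m y.
Proof.
apply/matrixP => i j; rewrite !ord1 !mxE; apply: eq_bigr => k _.
by rewrite mxE.
Qed.

Lemma dotv_eq0 x : dotv x x = 0 -> x = 0.
Proof.
move=> h; apply/matrixP => i j; rewrite ord1 mxE; apply/eqP.
rewrite -sqrf_eq0 expr2; move/eqP: h; rewrite psumr_eq0; last first.
  by move=> k _; rewrite -expr2 sqr_ge0.
by move/allP/(_ i); rewrite mem_index_enum => /(_ isT).
Qed.

Lemma enorm_sqr x : enorm x ^+ 2 = dotv x x.
Proof.
by rewrite sqr_sqrtr//; apply: sumr_ge0 => i _; rewrite -expr2 sqr_ge0.
Qed.

Lemma presentationP A V : presentation A V <-> V^T *m V = A.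
Proof.
have E i j : (V^T *m V) i j = dotv (col i V) (col j V).
  by rewrite mxE; apply: eq_bigr => k _; rewrite !mxE.
split=> [h|<- i j]; last by rewrite E.
by apply/matrixP => i j; rewrite E h.
Qed.

Lemma mulmx_sum_col V b : V *m b = \sum_(i < n) b i 0 *: col i V.
Proof.
apply/matrixP => k l; rewrite ord1 mxE summxE; apply: eq_bigr => i _.
by rewrite !mxE mulrC.
Qed.

Lemma ones_mulmx b : (ones^T *m b = 1%:M) <-> \sum_(i < n) b i 0 = 1.
Proof.
have E : ones^T *m b = (\sum_(i < n) b i 0)%:M.
  rewrite -dotvE; congr (_%:M); apply: eq_bigr => i _.
  by rewrite mxE mul1r.
rewrite E; split=> [/matrixP/(_ 0 0)|->//].
by rewrite !mxE.
Qed.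

Lemma ones_delta i : ones^T *m (delta_mx i 0 : 'cV[R]_n) = 1%:M.
Proof.
apply/ones_mulmx; rewrite (bigD1 i)//= big1 ?mxE ?eqxx ?addr0// => j ji.
by rewrite mxE (negbTE ji).
Qed.

Lemma affP V x : aff V x <-> exists2 b, ones^T *m b = 1%:M & x = V *m b.
Proof.
split=> [[a [a1 ->]]|[b b1 ->]].
  exists (\col_i a i).
    by apply/ones_mulmx; rewrite -[RHS]a1; apply: eq_bigr => i _; rewrite mxE.
  by rewrite mulmx_sum_col; apply: eq_bigr => i _; rewrite mxE.
by exists (fun i => b i 0); split; [exact/ones_mulmx|exact: mulmx_sum_col].
Qed.

Lemma conv_hullP V x : conv_hull V x <->
  exists b, [/\ forall i, 0 <= b i 0, ones^T *m b = 1%:M & x = V *m b].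
Proof.
split=> [[a [a0 a1 ->]]|[b [b0 b1 ->]]].
  exists (\col_i a i); split=> [i||]; first by rewrite mxE.
    by apply/ones_mulmx; rewrite -[RHS]a1; apply: eq_bigr => i _; rewrite mxE.
  by rewrite mulmx_sum_col; apply: eq_bigr => i _; rewrite mxE.
exists (fun i => b i 0).
by split=> //; [exact/ones_mulmx|exact: mulmx_sum_col].
Qed.

Lemma col_conv_hull V i : conv_hull V (col i V).
Proof.
apply/conv_hullP; exists (delta_mx i 0); split; last by rewrite colE.
  by move=> j; rewrite mxE ler0n.
exact: ones_delta.
Qed.

(** Affine combinations of affine combinations of the columns are again of that form. This turns the
    hull in [good_position] into [aff V]. *)
Lemma affine_hull_conv V : affine_hull (conv_hull V) = aff V.
Proof.
apply/seteqP; split=> x; last first.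
  case=> a [a1 ->]; exists n, a, (fun i => col i V); split=> // i.
  exact: col_conv_hull.
case=> m [a [p [pC a1 ->]]].
have /choice[f fP] i : exists b, ones^T *m b = 1%:M /\ p i = V *m b.
  by have /conv_hullP[b [_ b1 ->]] := pC i; exists b.
apply/affP; exists (\sum_(i < m) a i *: f i).
  rewrite mulmx_sumr -[1 in RHS]a1 raddf_sum; apply: eq_bigr => i _.
  by rewrite -scalemxAr (fP i).1 scale_scalar_mx mulr1.
rewrite mulmx_sumr; apply: eq_bigr => i _.
by rewrite -scalemxAr -(fP i).2.
Qed.

(** * Affine independence and barycentric coordinates *)

Definition affinely_independent V :=
  forall x, V *m x = 0 -> ones^T *m x = 0 -> x = 0.

Lemma affinely_independent_inj V a b : affinely_independent V ->
  ones^T *m a = 1%:M -> ones^T *m b = 1%:M -> V *m a = V *m b -> a = b.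
Proof.
move=> Vi a1 b1 ab; apply/eqP; rewrite -subr_eq0; apply/eqP/Vi.
  by rewrite mulmxBr ab subrr.
by rewrite mulmxBr a1 b1 subrr.
Qed.

(** Stacking [V] on the row [ones^T] gives an injective matrix, and the two blocks of a left inverse
    are [M] and [c]. Barycentric coordinates are thus affine, hence continuous, in the point. *)
Lemma barycentric_coordinates V : affinely_independent V ->
  exists (M : 'M[R]_n) c, forall b, ones^T *m b = 1%:M -> b = M *m (V *m b) + c.
Proof.
move=> Vi; pose W := col_mx V (ones^T : 'rV[R]_n).
have /row_freeP[N NW] : row_free W^T.
  apply: inj_row_free => v vW; apply: trmx_inj; rewrite trmx0.
  have : W *m v^T = 0 by rewrite -[W]trmxK -trmx_mul vW trmx0.
  rewrite mul_col_mx -col_mx0 => /eq_col_mx[]; exact: Vi.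
have {NW} : lsubmx N^T *m V + rsubmx N^T *m ones^T = 1%:M.
  by rewrite -mul_row_col hsubmxK -/W -[W]trmxK -trmx_mul NW trmx1.
move=> E; exists (lsubmx N^T), (rsubmx N^T) => b b1.
have -> : rsubmx N^T = rsubmx N^T *m (ones^T *m b) by rewrite b1 mulmx1.
by rewrite !mulmxA -mulmxDl E mul1mx.
Qed.

(** * Relative interior and dimension of a simplex *)

Lemma nbhs_affine_gt0 (M : 'M[R]_n) c x : (forall i, 0 < (M *m x + c) i 0) ->
  nbhs x [set y : 'cV[R]_n | forall i, 0 < (M *m y + c) i 0].
Proof.
move=> x0; pose K i := \sum_j `|M i j|.
(* A sup-norm displacement below [S^-1] changes coordinate [i] by at most [S^-1 * K i]; the summand
   1 keeps this strictly below the value at [x]. *)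
pose S := 1 + \sum_i K i / (M *m x + c) i 0.
have K0 i : 0 <= K i by apply: sumr_ge0.
have KS0 i : 0 <= K i / (M *m x + c) i 0 by rewrite divr_ge0// ltW.
have S0 : 0 < S by rewrite ltr_wpDr// sumr_ge0.
have SK i : S^-1 * K i < (M *m x + c) i 0.
  rewrite mulrC ltr_pdivrMr// mulrC -ltr_pdivrMr//.
  rewrite /S (bigD1 i)//= addrCA ltrDl ltr_wpDr// sumr_ge0//.
apply/nbhs_ballP; exists S^-1; rewrite /= ?invr_gt0//.
move=> y [_ xy] i /=.
have -> : (M *m y + c) i 0 = (M *m x + c) i 0 - (M *m (x - y)) i 0.
  by rewrite mulmxBr !mxE opprB [RHS]addrC addrA subrK.
rewrite subr_gt0; apply: le_lt_trans (SK i); apply: le_trans (ler_norm _) _.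
rewrite mxE mulr_sumr; apply: le_trans (ler_norm_sum _ _ _) _.
apply: ler_sum => j _; rewrite normrM mulrC ler_wpM2r//.
by rewrite !mxE ltW//; exact: xy.
Qed.

Lemma nbhs_segment x v (P : set 'cV[R]_n) : nbhs x P ->
  exists2 t : R, 0 < t & P (x + t *: v).
Proof.
case/nbhs_ballP => e /= e0 eP; pose K := 1 + \sum_j `|v j 0|.
have K0 : 0 < K by rewrite ltr_wpDr// sumr_ge0.
exists (e / K); first by rewrite divr_gt0.
apply: eP; split=> // i j; rewrite ord1.
rewrite -[ball _ _ _]/(is_true (`|x i 0 - (x + (e / K) *: v) i 0| < e)).
rewrite !mxE opprD addNKr normrN.
rewrite normrM gtr0_norm ?divr_gt0// mulrAC ltr_pdivrMr// ltr_pM2l//.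
by rewrite /K (bigD1 i)//= addrCA ltrDl ltr_wpDr// sumr_ge0.
Qed.

Lemma rel_interior_simplex V a : affinely_independent V ->
  ones^T *m a = 1%:M ->
  rel_interior (aff V) (conv_hull V) (V *m a) <-> forall i, 0 < a i 0.
Proof.
move=> Vi a1; split=> [[_ inta] i|a0]; last first.
  split; first by apply/affP; exists a.
  have [M [c Mc]] := barycentric_coordinates Vi.
  apply: filterS (nbhs_affine_gt0 (M := M) (c := c) (x := V *m a) _); last first.
    by move=> i; rewrite -Mc.
  move=> y y0 /affP[b b1 yE]; apply/conv_hullP; exists b; split=> // i.
  by rewrite ltW// (Mc b b1) -yE.
rewrite ltNge; apply/negP => ai.
(* Moving away from vertex [i] preserves the coordinate sum and replaces [a i 0] by
   [a i 0 + t * (a i 0 - 1)], which is negative if [a i 0 <= 0]. *)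
pose v := a - delta_mx i 0.
have [t t0 yP] := nbhs_segment (V *m v) inta.
have at1 : ones^T *m (a + t *: v) = 1%:M.
  by rewrite mulmxDr -scalemxAr mulmxBr a1 ones_delta subrr scaler0 addr0.
have yE : V *m a + t *: (V *m v) = V *m (a + t *: v).
  by rewrite [RHS]mulmxDr -scalemxAr.
rewrite yE in yP.
have /conv_hullP[b [b0 b1 bE]] : conv_hull V (V *m (a + t *: v)).
  by apply: yP; apply/affP; exists (a + t *: v).
have := b0 i; rewrite -(affinely_independent_inj Vi at1 b1 bE).
rewrite !mxE !eqxx leNgt => /negP; apply.
by rewrite -[ltRHS]addr0 ler_ltD// pmulr_rlt0// subr_lt0 (le_lt_trans ai).
Qed.

(** Since [aff V] contains the origin, it is the whole image of [V]; the kernel is the line spanned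
    by [a], so rank-nullity gives the dimension. *)
Lemma has_dim_conv_hull V a : ones^T *m a = 1%:M -> V *m a = 0 ->
  affinely_independent V -> has_dim (conv_hull V) n.-1.
Proof.
move=> a1 Va Vi; pose f : 'Hom('cV[R]_n, 'cV[R]_n) := linfun (mulmx V).
have fE x : f x = V *m x by rewrite lfunE.
exists 0, (limg f); split.
  rewrite affine_hull_conv; apply/seteqP; split=> x /=; rewrite subr0.
    by case/affP => b _ ->; rewrite -fE memv_img// memvf.
  case/memv_imgP => b _ ->; rewrite fE; apply/affP.
  (* Adding a multiple of [a], which [V] kills, makes the coordinate sum 1 without moving the
     point. *)
  exists (b + (1 - (ones^T *m b) 0 0) *: a).
    rewrite mulmxDr -scalemxAr a1; apply/matrixP => i j.
    by rewrite !ord1 !mxE eqxx mulr1 mulr1n addrC subrK.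
  by rewrite mulmxDr -scalemxAr Va scaler0 addr0.
have kerE : lker f = <[a]>%VS.
  apply/vspaceP => x; rewrite memv_ker fE; apply/eqP/vlineP => [Vx|[k ->]].
    (* With this factor, the difference of [x] and the multiple of [a] has coordinate sum 0 and is
       killed by [V]. *)
    exists ((ones^T *m x) 0 0); apply/eqP; rewrite -subr_eq0; apply/eqP/Vi.
      by rewrite mulmxBr -scalemxAr Vx Va scaler0 subr0.
    rewrite mulmxBr -scalemxAr a1; apply/matrixP => i j.
    by rewrite !ord1 mxE [in X in _ + X]mxE !mxE eqxx mulr1 subrr.
  by rewrite -scalemxAr Va scaler0.
have a0 : a != 0.
  apply/eqP => a0; move: a1; rewrite a0 mulmx0 => /matrixP/(_ 0 0).
  by rewrite !mxE => /esym/eqP; rewrite oner_eq0.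
have := limg_ker_dim f fullv.
have dimE : dim 'cV[R]_n = n by rewrite dim_matrix; exact: muln1.
by rewrite capfv kerE dim_vline a0 dimvf dimE => /(congr1 predn).
Qed.

End Barycentric.

(** * The projection formula and the equivalences *)

Theorem theorem4 (R : realType) (n : nat) (A U : 'M[R]_n) (u0 : 'cV[R]_n)
    (A_sym : symmetric_mx A) (A_pd : positive_definite A)
    (U_pres : presentation A U)
    (u0_proj : is_orth_proj (aff U) 0 u0) :
  u0 = (1 / (ones^T *m invmx A *m ones) 0 0) *: (U *m invmx A *m ones) /\
  let P1 := exists V : 'M[R]_n,
    presentation (A - enorm u0 ^+ 2 *: (ones *m ones^T)) V /\
    good_position V in
  let P2 := rel_interior (aff U) (conv_hull U) u0 in
  let P3 := forall i : 'I_n, 0 < (invmx A *m ones) i 0 in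
  (P1 <-> P2) /\ (P2 <-> P3).
Proof.
have kerA (x : 'cV[R]_n) : A *m x = 0 -> x = 0.
  move=> Ax; apply/eqP; apply: contraT => /A_pd.
  by rewrite -mulmxA Ax mulmx0 mxE ltxx.
have Au : A \in unitmx.
  rewrite -unitmx_tr A_sym -row_free_unit; apply: inj_row_free => v vA.
  apply: trmx_inj; rewrite trmx0; apply: kerA.
  by rewrite -A_sym -trmx_mul vA trmx0.
have UA : U^T *m U = A by apply/presentationP.
case: u0_proj => /affP[a a1 u0E] orth.
set c := enorm u0 ^+ 2.
have cE : u0^T *m u0 = c%:M by rewrite /c enorm_sqr dotvE.
(* Entry [i] of [A *m a = U^T *m u0] is the scalar product of [u0] with column [i], which
   orthogonality to [col i U - u0] makes equal to [c]. *)
have Aa : A *m a = c *: ones.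
  rewrite -UA -mulmxA -u0E; apply/matrixP => i j; rewrite ord1.
  have u_i : aff U (col i U).
    rewrite -affine_hull_conv; exists 1%N, (fun=> 1), (fun=> col i U).
    by rewrite !big_ord1 scale1r; split=> // _; exact: col_conv_hull.
  have /eqP : u0^T *m (col i U - u0) = 0.
    have := dotvE (0 - u0) (col i U - u0); rewrite orth// sub0r linearN /=.
    by rewrite mulNmx raddf0 => /esym/eqP; rewrite oppr_eq0 => /eqP.
  rewrite mulmxBr subr_eq0 cE => /eqP/matrixP/(_ 0 0); rewrite !mxE eqxx mulr1 mulr1n => <-.
  by apply: eq_bigr => k _; rewrite !mxE mulrC.
set w := invmx A *m ones.
have aE : a = c *: w by rewrite scalemxAr -Aa mulKmx.
pose s := (ones^T *m w) 0 0.
(* The coordinates of [a = c *: w] sum to 1. Hence [c] is the inverse of [s] and nonzero, so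
   positive, and [a] and [w] have the same signs. *)
have cs : c * s = 1.
  move: a1; rewrite aE -scalemxAr => /matrixP/(_ 0 0).
  by rewrite mxE [RHS]mxE.
have c0 : 0 < c.
  rewrite lt_def exprn_ge0 ?sqrtr_ge0// andbT; apply/eqP => c0.
  by move: cs; rewrite c0 mul0r => /eqP; rewrite eq_sym oner_eq0.
have a_gt0 : (forall i, 0 < a i 0) <-> (forall i, 0 < w i 0).
  have E i : a i 0 = c * w i 0 by rewrite aE mxE.
  by split=> h i; have := h i; rewrite E pmulr_rgt0.
have U_indep : affinely_independent U.
  by move=> x Ux _; apply: kerA; rewrite -UA -mulmxA Ux mulmx0.
have P23 : rel_interior (aff U) (conv_hull U) u0 <-> forall i, 0 < w i 0.
  by rewrite u0E; apply: iff_trans a_gt0; exact: rel_interior_simplex.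
split.
  rewrite -!mulmxA -/w -/s div1r u0E aE -scalemxAr; congr (_ *: _).
  have s0 : s != 0.
    by apply: contra_eq_neq cs => ->; rewrite mulr0 eq_sym oner_eq0.
  by apply: (mulIf s0); rewrite mulVf.
move=> P1 P2 P3; split; last exact: P23.
apply: iff_trans (iff_sym P23); apply: iff_trans a_gt0.
(* The squared norm of [V *m a] is the value at [a] of the form with matrix
   [A - c *: (ones *m ones^T)], which kills [a]. On vectors of coordinate sum 0 this matrix acts as
   [A], which is injective. *)
have V_facts V : presentation (A - c *: (ones *m ones^T)) V ->
    V *m a = 0 /\ affinely_independent V.
  move/presentationP => VA; split.
    apply: dotv_eq0; have := dotvE (V *m a) (V *m a).
    rewrite trmx_mul -mulmxA (mulmxA V^T) VA mulmxBl Aa -scalemxAl -mulmxA a1.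
    by rewrite mulmx1 subrr mulmx0 => /matrixP/(_ 0 0); rewrite !mxE.
  move=> x Vx x0; apply: kerA.
  have : V^T *m V *m x = 0 by rewrite -mulmxA Vx mulmx0.
  by rewrite VA mulmxBl -scalemxAl -mulmxA x0 mulmx0 scaler0 subr0.
split=> [[V [/V_facts[Va Vi] [_]]]|a0].
  by rewrite affine_hull_conv -Va => /(rel_interior_simplex Vi a1).
(* In the Gram matrix of the translated columns, each cross term contributes
   [- c *: (ones *m ones^T)], and the square of [u0] cancels one of the two. *)
have VA : presentation (A - c *: (ones *m ones^T)) (U - u0 *m ones^T).
  have Uu0 : U^T *m u0 = c *: ones by rewrite u0E mulmxA UA.
  have u0U : u0^T *m U = c *: ones^T.
    by apply: trmx_inj; rewrite trmx_mul trmxK Uu0 linearZ /= trmxK.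
  apply/presentationP; rewrite [(U - _)^T]linearB /= trmx_mul trmxK mulmxBl !mulmxBr UA.
  rewrite mulmxA Uu0 -!(mulmxA ones) u0U (mulmxA u0^T) cE mul_scalar_mx subrr.
  by rewrite subr0 -scalemxAl.
exists (U - u0 *m ones^T); split=> //.
have [Va Vi] := V_facts _ VA.
split; first exact: has_dim_conv_hull Va Vi.
by rewrite affine_hull_conv -Va; apply/rel_interior_simplex.
Qed.
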